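(* Fix a discretization parameter $\Delta=(\tau;\delta)$ with $\tau>0$ and $\delta=M/K$, $K\in\mathbb N$. From any monotone discrete initial datum $\vec{\mathrm x}_\Delta^0\in\mathfrak x_\delta$, a sequence of monotone vectors $\vec{\mathrm x}_\Delta^n=(x_1^n,\dots,x_{K-1}^n)\in\mathfrak x_\delta$, $n\ge1$, satisfying $$\frac{x^n_k-x^{n-1}_k}\tau = \frac1\delta\left[(z^n_{k+\frac12})^2\,\frac{z^n_{k+\frac32}-2z^n_{k+\frac12}+z^n_{k-\frac12}}{\delta^2}-(z^n_{k-\frac12})^2\,\frac{z^n_{k+\frac12}-2z^n_{k-\frac12}+z^n_{k-\frac32}}{\delta^2}\right],\qquad k=1,\dots,K-1,$$ can be constructed by inductively defining $\vec{\mathrm x}_\Delta^n$ as a global minimizer over $\mathfrak x_\delta$ of $$\vec{\mathrm x}\mapsto\frac\delta{2\tau}\sum_{k=1}^{K-1}\big(x_k-x_k^{n-1}\big)^2+\mathbf F_\delta(\vec{\mathrm x}).$$ This sequence of vectors $\vec{\mathrm x}_\Delta^n$ and the associated densities $\bar u_\Delta^n$ have the following properties: \begin{itemize} \item Positivity: $\bar u_\Delta^n$ is a strictly positive function. \item Mass conservation: $\bar u_\Delta^n$ has mass equal to $M$. \item Dissipation: $\mathbf H_\delta(\vec{\mathrm x}_\Delta^n)\le\mathbf H_\delta(\vec{\mathrm x}_\Delta^{n-1})$ and $\mathbf F_\delta(\vec{\mathrm x}_\Delta^n)\le\mathbf F_\delta(\vec{\mathrm x}_\Delta^{n-1})$.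 \item Equilibration: there is a constant $r>0$ only depending on $b-a$ such that $\mathbf H_\delta(\vec{\mathrm x}_\Delta^n)\le\mathbf H_\delta(\vec{\mathrm x}_\Delta^0)\,e^{-rn\tau}$. \end{itemize}
   Context: Fix $a<b$, $\Omega=[a,b]$ and a total mass $M>0$. For $K\in\mathbb N$ let $\delta=M/K$. The set of monotone grid vectors is $\mathfrak x_\delta=\{\vec{\mathrm x}=(x_1,\dots,x_{K-1}) : a<x_1<\dots<x_{K-1}<b\}$, with the convention $x_0=a$, $x_K=b$. For $\vec{\mathrm x}\in\mathfrak x_\delta$ put $z_\kappa=\delta/(x_{\kappa+\frac12}-x_{\kappa-\frac12})$ for $\kappa\in\{\frac12,\frac32,\dots,K-\frac12\}$, with the convention $z_{-\frac12}=z_{\frac12}$, $z_{K+\frac12}=z_{K-\frac12}$; for $\vec{\mathrm x}=\vec{\mathrm x}_\Delta^n$ these are written $z^n_\kappa$. The density associated to $\vec{\mathrm x}_\Delta^n$ is the piecewise constant function $\bar u_\Delta^n:\Omega\to\mathbb R$ with $\bar u_\Delta^n(x)=\delta/(x^n_k-x^n_{k-1})$ for $x^n_{k-1}<x\le x^n_k$, $k=1,\dots,K$. The discrete entropy and the discrete Fisher information are $$\mathbf H_\delta(\vec{\mathrm x})=\delta\sum_{k=1}^K\ln z_{k-\frac12}-M\ln\Big(\frac M{b-a}\Big),\qquad \mathbf F_\delta(\vec{\mathrm x})=\frac\delta2\sum_{k=1}^{K-1}\Big(\frac{z_{k+\frac12}-z_{k-\frac12}}\delta\Big)^2.$$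
   Formalization: Equilibration fails with r depending only on b−a for all τ>0 (K=2: one step with large τ reduces the entropy only algebraically in τ); here r depends on b−a and on an arbitrary upper bound T for τ. *)

(* Defs.v *)
From HB Require Import structures.
From mathcomp Require Import all_boot all_order all_algebra.
From mathcomp Require Import all_classical all_reals all_analysis.

Set Implicit Arguments.
Unset Strict Implicit.
Unset Printing Implicit Defensive.

Import Order.TTheory GRing.Theory Num.Theory.
Local Open Scope classical_set_scope.
Local Open Scope ring_scope.

Definition delta (R : realType) (M : R) (K : nat) : R := M / K%:R.

(* The vector (x_1, ..., x_{K-1}) is a row vector whose entries are numbered
   from 0: [node a b K x k] is x_k, with x_0 = a, and x_k = b for k >= K. *)
Definition node (R : realType) (a b : R) (K : nat) (x : 'rV[R]_K.-1)
    (k : nat) : R :=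
  if k is j.+1 then (if insub j is Some i then x ord0 i else b) else a.
Arguments node {R} a b K x k.

Definition monotone_vectors (R : realType) (a b : R) (K : nat) :
    set 'rV[R]_K.-1 :=
  [set x | forall k, (k < K)%N -> node a b K x k < node a b K x k.+1].
Arguments monotone_vectors {R} a b K.

(* Half-integer indices are shifted: [zval a b M K x k] is z_{k-1/2}. Clamping k
   to [1, K] encodes the conventions z_{-1/2} = z_{1/2} and
   z_{K+1/2} = z_{K-1/2}, i.e. zval 0 = zval 1 and zval K.+1 = zval K. *)
Definition zval (R : realType) (a b M : R) (K : nat) (x : 'rV[R]_K.-1)
    (k : nat) : R :=
  let j := minn (maxn k 1) K in
  delta M K / (node a b K x j - node a b K x j.-1).
Arguments zval {R} a b M K x k.

(* The cells are ]x_{k-1}, x_k], k = 1, ..., K, except that the first one is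
   closed on the left, so that they cover all of [a, b]. *)
Definition cell (R : realType) (a b : R) (K : nat) (x : 'rV[R]_K.-1)
    (k : nat) : set R :=
  if k == 1%N then `[node a b K x 0%N, node a b K x 1%N]%classic
  else `]node a b K x k.-1, node a b K x k]%classic.
Arguments cell {R} a b K x k.

Definition density (R : realType) (a b M : R) (K : nat) (x : 'rV[R]_K.-1)
    (t : R) : R :=
  \sum_(1 <= k < K.+1)
    (delta M K / (node a b K x k - node a b K x k.-1)) * \1_(cell a b K x k) t.
Arguments density {R} a b M K x t.

Definition entropy (R : realType) (a b M : R) (K : nat) (x : 'rV[R]_K.-1) : R :=
  delta M K * (\sum_(1 <= k < K.+1) ln (zval a b M K x k))
  - M * ln (M / (b - a)).
Arguments entropy {R} a b M K x.

Definition fisher (R : realType) (a b M : R) (K : nat) (x : 'rV[R]_K.-1) : R :=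
  delta M K / 2 *
  \sum_(1 <= k < K) ((zval a b M K x k.+1 - zval a b M K x k) / delta M K) ^+ 2.
Arguments fisher {R} a b M K x.

Definition step_functional (R : realType) (a b M tau : R) (K : nat)
    (y x : 'rV[R]_K.-1) : R :=
  delta M K / (2 * tau) *
    (\sum_(1 <= k < K) (node a b K x k - node a b K y k) ^+ 2)
  + fisher a b M K x.
Arguments step_functional {R} a b M tau K y x.

Definition global_minimizer (T : Type) (R : realType) (A : set T) (J : T -> R)
    (x : T) : Prop :=
  A x /\ forall y, A y -> J x <= J y.

Definition minimizing_scheme (R : realType) (a b M tau : R) (K : nat)
    (x0 : 'rV[R]_K.-1) (x : nat -> 'rV[R]_K.-1) : Prop :=
  x 0%N = x0 /\
  forall n, global_minimizer (monotone_vectors a b K)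
              (step_functional a b M tau K (x n)) (x n.+1).
Arguments minimizing_scheme {R} a b M tau K x0 x.

Definition second_difference (R : realType) (a b M : R) (K : nat)
    (x : 'rV[R]_K.-1) (k : nat) : R :=
  (zval a b M K x k.+1 - 2 * zval a b M K x k + zval a b M K x k.-1)
  / delta M K ^+ 2.
Arguments second_difference {R} a b M K x k.

(* One step of the discrete evolution equation, from y to x; second_difference
   carries the same index shift as zval. *)
Definition discrete_evolution (R : realType) (a b M tau : R) (K : nat)
    (y x : 'rV[R]_K.-1) : Prop :=
  forall k, (1 <= k < K)%N ->
    (node a b K x k - node a b K y k) / tau =
    (delta M K)^-1 *
      (zval a b M K x k.+1 ^+ 2 * second_difference a b M K x k.+1
       - zval a b M K x k ^+ 2 * second_difference a b M K x k).
Arguments discrete_evolution {R} a b M tau K y x.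

(* Main.v *)
Require Import Defs.
From HB Require Import structures.
From mathcomp Require Import all_boot all_order all_algebra.
From mathcomp Require Import all_classical all_reals all_analysis.
From mathcomp Require Import ring lra zify.

Set Implicit Arguments.
Unset Strict Implicit.
Unset Printing Implicit Defensive.

Import Order.TTheory GRing.Theory Num.Theory.
Import numFieldNormedType.Exports.
Local Open Scope classical_set_scope.
Local Open Scope ring_scope.

(** Write L = b - a, d_k = z_(k+1/2) - z_(k-1/2), and l_k = delta / z_(k-1/2) for
    the length of the k-th cell.

    The partial derivative of the entropy with respect to x_k is d_k, and the
    Fisher information is proportional to the squared gradient of the entropy;
    the scheme is the minimizing-movement scheme for it.

    Existence.  A bound on the Fisher information bounds the increments of z, and
    some z is at most the mean density M / L; so z is bounded from above and the
    cell lengths are bounded from below ([zval_le]).  A sublevel set of the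
    functional therefore lies in a compact set of vectors with separated nodes, on
    which the functional is continuous ([exists_minimizer]).  The monotone vectors
    form an open set, so all partial derivatives vanish at a minimizer; summation
    by parts turns this into the evolution equation ([minimizer_evolution]).
    Comparison of the minimizer with the previous vector gives the decay of the
    Fisher information.

    Entropy.  The entropy is a convex function of the nodes, because the logarithm
    is concave, so its decrease in one step is at least minus its derivative at the
    new vector in the direction of the step.  Inserting the evolution equation and
    summing by parts, this quantity is tau times
    A = delta * sum_k z_k^2 (D^2 z)_k^2, where D^2 is the second difference
    quotient ([entropy_step_le]).

    Equilibration.  It remains to bound the entropy by 4 L^4 A
    ([entropy_le_dissipation]).  In the continuous setting, with g = (ln u)', A is
    the integral of u g'^2.  If g(x) < 0, move to the left of x until the first
    zero of g, which exists because g vanishes at the endpoints.  On this interval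
    u >= u(x), so Cauchy--Schwarz gives
    u(x) g(x)^2 <= L u(x) int g'^2 <= L int u g'^2 <= L A; the case g(x) > 0 is
    symmetric.  Since u g^2 = 4 ((sqrt u)')^2, this is a Lipschitz bound for sqrt u,
    and it controls the distance of u to its mean pointwise, hence also the
    relative entropy.  The argument carries over to the grid with no loss
    ([slope_le], [sqrt_oscillation], [relative_entropy_le]).

    One step thus divides the entropy at least by 1 + tau / (4 L^4).  For tau <= T
    this factor is at least exp (r tau) with r = 1 / (4 L^4 + T). *)

(** * Sums over the grid *)

Lemma sum_by_parts (R : realType) (K : nat) (p q : nat -> R) :
  (0 < K)%N -> p 0%N = 0 -> p K = 0 ->
  \sum_(1 <= k < K) p k * (q k.+1 - q k) =
  - \sum_(1 <= k < K.+1) (p k - p k.-1) * q k.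
Proof.
move=> K0 p0 pK.
have H n : \sum_(1 <= k < n.+1) p k * (q k.+1 - q k) =
    p n * q n.+1 - \sum_(1 <= k < n.+1) (p k - p k.-1) * q k.
  elim: n => [|n IH]; first by rewrite !big_geq// p0; ring.
  by rewrite big_nat_recr//= IH [in RHS]big_nat_recr//=; ring.
have := H K; rewrite pK mul0r sub0r => <-.
by rewrite [in RHS]big_nat_recr//= pK mul0r addr0.
Qed.

Lemma ler_dist_sum (R : realType) (K : nat) (u : nat -> R) (i j : nat) :
  (1 <= i <= K)%N -> (1 <= j <= K)%N ->
  `|u i - u j| <= \sum_(1 <= k < K) `|u k.+1 - u k|.
Proof.
wlog ij : i j / (j <= i)%N.
  move=> W Hi Hj; case: (leqP j i) => [|/ltnW] ij; first exact: W.
  by rewrite distrC; exact: W.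
move=> /andP[i1 iK] /andP[j1 jK].
rewrite -(telescope_sumr u ij) (le_trans (ler_norm_sum _ _ _))//.
rewrite (big_cat_nat j1 jK)/= (big_cat_nat ij iK)/=.
rewrite ler_wpDl ?sumr_ge0// lerDl sumr_ge0//.
Qed.

(** Applied to weighted deviations from a mean, it finds a value on a given side of
    the mean, which replaces the intermediate value theorem on the grid. *)
Lemma exists_ge0_of_sum0 (R : realType) (K : nat) (f : nat -> R) :
  (0 < K)%N -> \sum_(1 <= k < K.+1) f k = 0 ->
  exists2 k, (1 <= k <= K)%N & 0 <= f k.
Proof.
move=> K0 f0; apply: contrapT => nf.
suff : \sum_(1 <= k < K.+1) f k < \sum_(1 <= k < K.+1) 0.
  by rewrite f0 big1// ltxx.
apply: ltr_sum_nat => // k kK; rewrite ltNge; apply/negP => fk.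
by apply: nf; exists k.
Qed.

(** Cauchy--Schwarz for two summands; it is the induction step that adds one cell in
    [slope_le_downhill]. *)
Lemma sqrrD_le_mulD (R : realType) (p q s t S T : R) :
  0 <= s -> 0 <= t -> 0 <= S -> 0 <= T ->
  p ^+ 2 <= s * S -> q ^+ 2 <= t * T -> (p + q) ^+ 2 <= (s + t) * (S + T).
Proof.
move=> s0 t0 S0 T0 pS qT.
suff : `|2 * p * q| <= `|s * T + t * S|.
  rewrite (ger0_norm (_ : 0 <= s * T + t * S)) ?addr_ge0 ?mulr_ge0//.
  move=> /(le_trans (ler_norm _)); nra.
rewrite -ler_sqr ?nnegrE// !real_normK ?num_real//.
have : p ^+ 2 * q ^+ 2 <= (s * S) * (t * T) by rewrite ler_pM ?sqr_ge0.
have := sqr_ge0 (s * T - t * S); nra.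
Qed.

(** * A Poincare-type inequality weighted by the density *)

(** While z decreases from cell to cell, all earlier values of z in the run are at
    least the current one, so the Cauchy--Schwarz bound for the accumulated slope can
    carry the current value of z as a common weight.  The run starts where the slope
    is nonnegative, at the latest at the boundary, where the slope is zero.  The
    induction never needs to name the start of the run: at each cell either the
    previous slope is negative and the bound is continued, or the whole negative slope
    was produced by the current second difference. *)
Lemma slope_le_downhill (R : realType) (dl : R) (K : nat) (l z : nat -> R) :
  0 < dl -> (forall k, (1 <= k <= K)%N -> 0 < z k) ->
  (forall k, (1 <= k <= K)%N -> z k * l k = dl) ->
  z 0%N = z 1%N ->
  forall k, (k <= K)%N -> z k.+1 < z k ->
  z k * (z k.+1 - z k) ^+ 2 <=
  (\sum_(1 <= j < k.+1) l j) *
  (\sum_(1 <= j < k.+1) z j ^+ 2 * (z j.+1 - 2 * z j + z j.-1) ^+ 2) / dl.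
Proof.
move=> dl0 z0 zl z01; elim=> [|k IH] kK; first by rewrite z01 ltxx.
have l0 j : (1 <= j <= K)%N -> 0 < l j.
  by move=> jK; have := dl0; rewrite -(zl j jK) pmulr_rgt0// z0.
move=> zd; rewrite big_nat_recr//= [X in _ * X / _]big_nat_recr//=.
set s := \sum_(_ <= _ < _) l _; set S := \sum_(_ <= _ < _) _.
have s0 : 0 <= s.
  rewrite /s big_nat sumr_ge0// => j /andP[j1 jk].
  by rewrite ltW// l0// j1/= (leq_trans _ kK)// ltnW.
have S0 : 0 <= S by rewrite sumr_ge0// => j _; rewrite mulr_ge0 ?sqr_ge0.
set w := z k.+2 - 2 * z k.+1 + z k.
have zk := z0 k.+1 kK; have lk := l0 k.+1 kK; have zlk := zl k.+1 kK.
have dE : z k.+2 - z k.+1 = (z k.+1 - z k) + w by rewrite /w; ring.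
have q2 : dl * (z k.+1 * w ^+ 2) = l k.+1 * (z k.+1 ^+ 2 * w ^+ 2).
  by rewrite -zlk; ring.
have T0 : 0 <= z k.+1 ^+ 2 * w ^+ 2 by rewrite mulr_ge0 ?sqr_ge0.
rewrite ler_pdivlMr// mulrC.
case: (ltP (z k.+1) (z k)) => zd1; last first.
  (* The run starts here: the slope is squeezed between w and 0. *)
  apply: (@le_trans _ _ (dl * (z k.+1 * w ^+ 2))).
    by rewrite ler_pM2l// ler_pM2l// dE; nra.
  by rewrite q2 ler_pM ?lerDr ?(ltW lk)//.
have zk0 : 0 < z k.
  by case: (k) zd1 kK => [|k'] _ kK; rewrite ?z01 z0//= ltnW.
have := IH (ltnW kK) zd1; rewrite -/s -/S ler_pdivlMr// => IH'.
(* Distribute the common weight over the two slopes to apply Cauchy--Schwarz. *)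
set e := Num.sqrt (dl * z k.+1).
have e2 : e ^+ 2 = dl * z k.+1 by rewrite sqr_sqrtr// mulr_ge0// ltW.
rewrite dE mulrA -e2 -exprMn mulrDr sqrrD_le_mulD ?(ltW lk)//.
  rewrite exprMn e2 (le_trans _ IH')// [leRHS]mulrC -mulrA.
  by rewrite ler_pM2l// ler_wpM2r ?sqr_ge0// ltW.
by rewrite exprMn e2 -mulrA q2.
Qed.

(** Runs on which z increases are runs on which the reversed sequence decreases, and
    the second differences are invariant under reversal. *)
Lemma slope_le (R : realType) (dl : R) (K : nat) (l z : nat -> R) :
  0 < dl -> (forall k, (1 <= k <= K)%N -> 0 < z k) ->
  (forall k, (1 <= k <= K)%N -> z k * l k = dl) ->
  z 0%N = z 1%N -> z K.+1 = z K ->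
  forall k, (1 <= k < K)%N ->
  Num.max (z k) (z k.+1) * (z k.+1 - z k) ^+ 2 <=
  (\sum_(1 <= j < K.+1) l j) *
  (\sum_(1 <= j < K.+1) z j ^+ 2 * (z j.+1 - 2 * z j + z j.-1) ^+ 2) / dl.
Proof.
move=> dl0 + + + + k.
wlog zd : z l k / z k.+1 <= z k.
  move=> W z0 zl z01 zK kK.
  have [zd|] := boolP (z k.+1 <= z k); first exact: W.
  rewrite -ltNge => zd.
  have /andP[k1 kK'] := kK.
  pose z' j := z (K.+1 - j)%N; pose l' j := l (K.+1 - j)%N.
  have rev j : (1 <= j <= K)%N -> (1 <= K.+1 - j <= K)%N.
    by lia.
  have := W z' l' (K - k)%N.
  have -> : z' (K - k)%N = z k.+1 by congr z; lia.
  have -> : z' (K - k).+1 = z k by congr z; lia.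
  rewrite maxC => /(_ (ltW zd)).
  rewrite (_ : (z k - z k.+1) ^+ 2 = (z k.+1 - z k) ^+ 2); last by ring.
  have -> : \sum_(1 <= j < K.+1) l' j = \sum_(1 <= j < K.+1) l j.
    rewrite big_nat_rev/=; apply: eq_big_nat => j jK.
    by congr l; lia.
  have -> : \sum_(1 <= j < K.+1) z' j ^+ 2 * (z' j.+1 - 2 * z' j + z' j.-1) ^+ 2
      = \sum_(1 <= j < K.+1) z j ^+ 2 * (z j.+1 - 2 * z j + z j.-1) ^+ 2.
    rewrite big_nat_rev/=; apply: eq_big_nat => j jK.
    have -> : z' (1 + K.+1 - j.+1)%N = z j by congr z; lia.
    have -> : z' (1 + K.+1 - j.+1).+1 = z j.-1 by congr z; lia.
    have -> : z' (1 + K.+1 - j.+1).-1 = z j.+1 by congr z; lia.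
    by ring.
  apply; last by lia.
  - by move=> j /rev; exact: z0.
  - by move=> j /rev; exact: zl.
  - by rewrite /z' subn0 subn1.
  - by rewrite /z' subnn subSnn.
move=> z0 zl z01 zK /andP[k1 kK].
have l0 j : (1 <= j <= K)%N -> 0 < l j.
  by move=> jK; have := dl0; rewrite -(zl j jK) pmulr_rgt0// z0.
have sl m n : (1 <= m)%N -> (n <= K.+1)%N -> 0 <= \sum_(m <= j < n) l j.
  move=> m1 nK; rewrite big_nat sumr_ge0// => j /andP[mj jn].
  by rewrite ltW// l0// (leq_trans m1 mj)/= -ltnS (leq_trans jn).
have sS m n : 0 <= \sum_(m <= j < n) z j ^+ 2 * (z j.+1 - 2 * z j + z j.-1) ^+ 2.
  by rewrite sumr_ge0// => j _; rewrite mulr_ge0 ?sqr_ge0.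
rewrite max_l//; move: zd; rewrite le_eqVlt => /orP[/eqP ->|zd].
  by rewrite subrr expr0n mulr0 divr_ge0 ?mulr_ge0 ?(ltW dl0)// sl.
apply: (le_trans (slope_le_downhill dl0 z0 zl z01 (ltnW kK) zd)).
rewrite ler_pM2r ?invr_gt0//.
have k1' : (1 <= k.+1)%N by [].
have kK' : (k.+1 <= K.+1)%N by rewrite ltnS ltnW.
rewrite ler_pM// ?sl// (big_cat_nat k1' kK')/= lerDl ?sl//.
Qed.

(** Since z_(k+1) - z_k factors as a difference times a sum of square roots, the weighted
    slope bound says that sqrt z changes by at most a constant times l_k from cell k to
    the next one, and the lengths l_k add up to L. *)
Lemma sqrt_oscillation (R : realType) (dl L A : R) (K : nat) (l z : nat -> R) :
  0 < dl -> (forall k, (1 <= k <= K)%N -> 0 < z k) ->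
  (forall k, (1 <= k <= K)%N -> z k * l k = dl) ->
  z 0%N = z 1%N -> z K.+1 = z K ->
  L = \sum_(1 <= j < K.+1) l j ->
  A = \sum_(1 <= j < K.+1) z j ^+ 2 * (z j.+1 - 2 * z j + z j.-1) ^+ 2 ->
  forall i j, (1 <= i <= K)%N -> (1 <= j <= K)%N ->
  (Num.sqrt (z i) - Num.sqrt (z j)) ^+ 2 <= L ^+ 3 * A / dl ^+ 3.
Proof.
move=> dl0 z0 zl z01 zK LE AE i j iK jK.
have l0 k : (1 <= k <= K)%N -> 0 < l k.
  by move=> kK; have := dl0; rewrite -(zl k kK) pmulr_rgt0// z0.
have L0 : 0 <= L.
  by rewrite LE big_nat sumr_ge0// => k kK; rewrite ltW// l0.
have A0 : 0 <= A.
  by rewrite AE sumr_ge0// => k _; rewrite mulr_ge0 ?sqr_ge0.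
set B := L * A / dl.
have B0 : 0 <= B by rewrite divr_ge0 ?mulr_ge0// ltW.
set c := Num.sqrt B / dl.
have c0 : 0 <= c by rewrite divr_ge0 ?sqrtr_ge0 ?(ltW dl0).
have step k : (1 <= k < K)%N ->
    `|Num.sqrt (z k.+1) - Num.sqrt (z k)| <= c * l k.
  move=> /andP[k1 kK].
  have zk : 0 < z k by rewrite z0// k1 ltnW.
  have zk1 : 0 < z k.+1 by rewrite z0.
  set s := Num.sqrt (z k.+1); set t := Num.sqrt (z k).
  have s0 : 0 <= s by exact: sqrtr_ge0.
  have t0 : 0 < t by rewrite sqrtr_gt0.
  have sE : z k.+1 = s ^+ 2 by rewrite sqr_sqrtr// ltW.
  have tE : z k = t ^+ 2 by rewrite sqr_sqrtr// ltW.
  have zlk : z k * l k = dl by rewrite zl// k1 ltnW.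
  have : z k * (z k.+1 - z k) ^+ 2 <= B.
    rewrite /B LE AE.
    have kK1 : (1 <= k < K)%N by rewrite k1.
    apply: le_trans (slope_le dl0 z0 zl z01 zK kK1).
    by rewrite ler_wpM2r ?sqr_ge0// le_max lexx.
  rewrite {1}tE sE {1}tE -exprMn => tB.
  have {}tB : t * (s + t) * `|s - t| <= Num.sqrt B.
    rewrite -ler_sqr ?nnegrE ?sqrtr_ge0 ?mulr_ge0 ?addr_ge0 ?(ltW t0)//.
    rewrite sqr_sqrtr// (_ : _ ^+ 2 = (t * (s ^+ 2 - t ^+ 2)) ^+ 2)//.
    by rewrite exprMn real_normK ?num_real//; ring.
  have -> : c * l k = Num.sqrt B / z k.
    rewrite /c -zlk; field; rewrite !gt_eqF// ?l0// k1 ltnW//.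
  rewrite ler_pdivlMr// tE; apply: le_trans tB.
  by rewrite mulrC ler_wpM2r// expr2 ler_pM2l// lerDr.
have osc : `|Num.sqrt (z i) - Num.sqrt (z j)| <= c * L.
  apply: (le_trans (ler_dist_sum (fun k => Num.sqrt (z k)) iK jK)).
  have K0 : (0 < K)%N by lia.
  rewrite LE mulr_sumr [leRHS]big_nat_recr//= ler_wpDr//.
    by rewrite mulr_ge0// ltW// l0// K0/=.
  by apply: ler_sum_nat => k kK; exact: step.
rewrite -real_normK ?num_real//.
have -> : L ^+ 3 * A / dl ^+ 3 = (c * L) ^+ 2.
  rewrite /c !exprMn sqr_sqrtr// /B exprVn; field; exact: lt0r_neq0.
by rewrite ler_sqr// nnegrE mulr_ge0.
Qed.

(** The inequality ln t <= t - 1 bounds the relative entropy by the variance of z,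
    weighted by the cell lengths and divided by the mean u = dl * K / L.  Some values of z
    lie above u and some below, so sqrt z stays within its oscillation of sqrt u; the
    remaining factor (sqrt z + sqrt u)^2 <= 2 (z + u) integrates to 4 times the mass. *)
Lemma relative_entropy_le (R : realType) (dl L A : R) (K : nat) (l z : nat -> R) :
  (0 < K)%N ->
  0 < dl -> (forall k, (1 <= k <= K)%N -> 0 < z k) ->
  (forall k, (1 <= k <= K)%N -> z k * l k = dl) ->
  z 0%N = z 1%N -> z K.+1 = z K ->
  L = \sum_(1 <= j < K.+1) l j ->
  A = \sum_(1 <= j < K.+1) z j ^+ 2 * (z j.+1 - 2 * z j + z j.-1) ^+ 2 ->
  dl * \sum_(1 <= k < K.+1) ln (z k / (dl * K%:R / L)) <=
  4 * L ^+ 4 * (A / dl ^+ 3).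
Proof.
move=> K0 dl0 z0 zl z01 zK LE AE.
have osc := sqrt_oscillation dl0 z0 zl z01 zK LE AE.
have l0 k : (1 <= k <= K)%N -> 0 < l k.
  by move=> kK; have := dl0; rewrite -(zl k kK) pmulr_rgt0// z0.
have L0 : 0 < L.
  suff : \sum_(1 <= j < K.+1) 0 < L by rewrite big1.
  by rewrite LE; apply: ltr_sum_nat => // k kK; exact: l0.
set M := dl * K%:R; set u := M / L.
have M0 : 0 < M by rewrite mulr_gt0// ltr0n.
have u0 : 0 < u by rewrite divr_gt0.
have uL : u * L = M by rewrite /u divfK// gt_eqF.
have sM : \sum_(1 <= k < K.+1) z k * l k = M.
  rewrite (eq_big_nat _ _ (F2 := fun=> dl)) => [|k kK]; last exact: zl.
  by rewrite sumr_const_nat subn1 /M mulr_natr.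
have s0 : \sum_(1 <= k < K.+1) l k * (z k - u) = 0.
  transitivity (\sum_(1 <= k < K.+1) z k * l k - u * \sum_(1 <= k < K.+1) l k).
    by rewrite mulr_sumr -sumrB; apply: eq_bigr => k _; ring.
  by rewrite sM -LE uL subrr.
set E := L ^+ 3 * A / dl ^+ 3.
have [i iK zi] := exists_ge0_of_sum0 K0 s0.
have [j jK zj] : exists2 j, (1 <= j <= K)%N & 0 <= - (l j * (z j - u)).
  by apply: exists_ge0_of_sum0 => //; rewrite sumrN s0 oppr0.
have {zi}ui : u <= z i by move: zi; rewrite pmulr_rge0 ?l0// subr_ge0.
have {zj}uj : z j <= u.
  by move: zj; rewrite -mulrN pmulr_rge0 ?l0// oppr_ge0 subr_le0.
have oscu k : (1 <= k <= K)%N -> (Num.sqrt (z k) - Num.sqrt u) ^+ 2 <= E.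
  move=> kK.
  have := osc _ _ kK iK; have := osc _ _ kK jK; rewrite -/E.
  have := ler_wsqrtr ui; have := ler_wsqrtr uj.
  move: (Num.sqrt (z k)) (Num.sqrt u) (Num.sqrt (z i)) (Num.sqrt (z j)).
  move=> p q s t; case: (lerP p q); nra.
have E0 : 0 <= E by apply: le_trans (oscu _ iK); exact: sqr_ge0.
have sqb k : (1 <= k <= K)%N -> (z k - u) ^+ 2 <= 2 * E * (z k + u).
  move=> kK; have := oscu k kK.
  rewrite -{2 3}(sqr_sqrtr (ltW (z0 k kK))) -{2 3}(sqr_sqrtr (ltW u0)).
  move: (Num.sqrt (z k)) (Num.sqrt u) => p q pq.
  have -> : (p ^+ 2 - q ^+ 2) ^+ 2 = (p - q) ^+ 2 * (p + q) ^+ 2 by ring.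
  have -> : 2 * E * (p ^+ 2 + q ^+ 2) = E * (2 * (p ^+ 2 + q ^+ 2)) by ring.
  rewrite ler_pM ?sqr_ge0//; have := sqr_ge0 (p - q); nra.
have -> : 4 * L ^+ 4 * (A / dl ^+ 3) = u^-1 * (2 * E * (M + u * L)).
  by rewrite uL /u /E; field; rewrite !gt_eqF.
apply: (@le_trans _ _ (u^-1 * \sum_(1 <= k < K.+1) l k * (z k - u) ^+ 2)); last first.
  rewrite ler_pM2l ?invr_gt0// -sM LE !mulr_sumr -big_split/= mulr_sumr.
  apply: ler_sum_nat => k kK.
  have -> : 2 * E * (z k * l k + u * l k) = l k * (2 * E * (z k + u)) by ring.
  by rewrite ler_pM2l ?l0// sqb.
(* The terms u * l_k * (z_k - u) that are added below sum to zero. *)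
have -> : u^-1 * \sum_(1 <= k < K.+1) l k * (z k - u) ^+ 2 =
    \sum_(1 <= k < K.+1) dl * (z k / u - 1).
  transitivity (u^-1 * \sum_(1 <= k < K.+1) (l k * (z k - u) ^+ 2
      + u * (l k * (z k - u)))).
    by rewrite big_split/= -mulr_sumr s0 mulr0 addr0.
  rewrite mulr_sumr; apply: eq_big_nat => k kK.
  by rewrite -(zl k kK); field; rewrite gt_eqF.
rewrite mulr_sumr; apply: ler_sum_nat => k kK; rewrite ler_pM2l//.
have := @le_ln1Dx R (z k / u - 1).
rewrite (_ : 1 + (z k / u - 1) = z k / u); last by ring.
by apply; have := divr_gt0 (z0 k kK) u0; lra.
Qed.

(** * Nodes and cell densities *)

Lemma node_ge_last (R : realType) (a b : R) (K : nat) (x : 'rV[R]_K.-1)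
    (k : nat) : (0 < K)%N -> (K <= k)%N -> node a b K x k = b.
Proof.
case: k => [|k] K0 Kk /=; first by lia.
by rewrite insubF//; apply/negbTE; rewrite -leqNgt; lia.
Qed.

Lemma node_last (R : realType) (a b : R) (K : nat) (x : 'rV[R]_K.-1) :
  (0 < K)%N -> node a b K x K = b.
Proof. by move=> K0; exact: node_ge_last. Qed.

Lemma zval_first (R : realType) (a b M : R) (K : nat) (x : 'rV[R]_K.-1) :
  zval a b M K x 0 = zval a b M K x 1.
Proof. by []. Qed.

Lemma zval_last (R : realType) (a b M : R) (K : nat) (x : 'rV[R]_K.-1) :
  (0 < K)%N -> zval a b M K x K.+1 = zval a b M K x K.
Proof.
move=> K0; rewrite /zval (_ : minn (maxn K.+1 1) K = K); last by lia.
by rewrite (_ : minn (maxn K 1) K = K)//; lia.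
Qed.

Lemma zvalE (R : realType) (a b M : R) (K : nat) (x : 'rV[R]_K.-1) (k : nat) :
  (1 <= k <= K)%N ->
  zval a b M K x k = delta M K / (node a b K x k - node a b K x k.-1).
Proof. by move=> kK; rewrite /zval (_ : minn (maxn k 1) K = k)//; lia. Qed.

Lemma sum_gap (R : realType) (a b : R) (K : nat) (x : 'rV[R]_K.-1) :
  (0 < K)%N ->
  \sum_(1 <= k < K.+1) (node a b K x k - node a b K x k.-1) = b - a.
Proof.
by move=> K0; rewrite big_add1/= telescope_sumr// node_last.
Qed.

Lemma gap_gt0 (R : realType) (a b : R) (K : nat) (x : 'rV[R]_K.-1) (k : nat) :
  monotone_vectors a b K x -> (1 <= k <= K)%N ->
  0 < node a b K x k - node a b K x k.-1.
Proof. by case: k => // k mx /andP[_ kK]; rewrite subr_gt0; exact: mx. Qed.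

Lemma delta_gt0 (R : realType) (M : R) (K : nat) :
  0 < M -> (0 < K)%N -> 0 < delta M K.
Proof. by move=> M0 K0; rewrite divr_gt0// ltr0n. Qed.

Lemma delta_mul (R : realType) (M : R) (K : nat) :
  (0 < K)%N -> delta M K * K%:R = M.
Proof. by move=> K0; rewrite divfK// gt_eqF// ltr0n. Qed.

Lemma zval_gt0 (R : realType) (a b M : R) (K : nat) (x : 'rV[R]_K.-1)
    (k : nat) :
  0 < M -> (0 < K)%N -> monotone_vectors a b K x -> (1 <= k <= K)%N ->
  0 < zval a b M K x k.
Proof.
by move=> M0 K0 mx kK; rewrite zvalE// divr_gt0 ?delta_gt0 ?gap_gt0.
Qed.

Lemma zval_gap (R : realType) (a b M : R) (K : nat) (x : 'rV[R]_K.-1)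
    (k : nat) :
  monotone_vectors a b K x -> (1 <= k <= K)%N ->
  zval a b M K x k * (node a b K x k - node a b K x k.-1) = delta M K.
Proof. by move=> mx kK; rewrite zvalE// divfK// gt_eqF// gap_gt0. Qed.

(** * Convexity, dissipation and decay of the entropy *)

(** The gradient inequality of a convex function, with the gradient taken at x: the
    logarithm of a quotient of cell lengths is bounded by the quotient minus one, and
    summation by parts collects the result by nodes. *)
Lemma entropy_diff_le (R : realType) (a b M : R) (K : nat)
    (x y : 'rV[R]_K.-1) :
  0 < M -> (0 < K)%N ->
  monotone_vectors a b K x -> monotone_vectors a b K y ->
  entropy a b M K x - entropy a b M K y <=
  \sum_(1 <= k < K) (node a b K x k - node a b K y k) *
                    (zval a b M K x k.+1 - zval a b M K x k).
Proof.
move=> M0 K0 mx my.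
set z := zval a b M K x; set p := fun k => node a b K x k - node a b K y k.
rewrite (@sum_by_parts _ K p z)//; [|by rewrite /p subrr|];
  last by rewrite /p !node_last// subrr.
rewrite /entropy [leLHS](_ : _ = delta M K *
  \sum_(1 <= k < K.+1) (ln (z k) - ln (zval a b M K y k))); last first.
  by rewrite sumrB; ring.
rewrite mulr_sumr -sumrN; apply: ler_sum_nat => k kK.
have zk := zval_gt0 M0 K0 mx kK; have zk' := zval_gt0 M0 K0 my kK.
have gx := gap_gt0 mx kK; have gy := gap_gt0 my kK.
have d0 := delta_gt0 M0 K0.
rewrite -ln_div ?posrE//.
set gX := _ - _ in gx; set gY := _ - _ in gy.
have zE : z k = delta M K / gX by rewrite /z zvalE.
have -> : z k / zval a b M K y k = 1 + (gY / gX - 1).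
  by rewrite zE [zval _ _ _ _ y _]zvalE// -/gY; field; rewrite !gt_eqF.
apply: (@le_trans _ _ (delta M K * (gY / gX - 1))).
  by rewrite ler_pM2l// le_ln1Dx//; have := divr_gt0 gy gx; lra.
have -> : p k - p k.-1 = gX - gY by rewrite /p /gX /gY; ring.
by rewrite zE le_eqVlt; apply/orP; left; apply/eqP; field; rewrite gt_eqF.
Qed.

(** The discrete analogue of the integral of u * ((ln u)'')^2: with the mass as
    coordinate, u times the second derivative of u equals (ln u)''. *)
Definition dissipation (R : realType) (a b M : R) (K : nat)
    (x : 'rV[R]_K.-1) : R :=
  delta M K * \sum_(1 <= k < K.+1)
    zval a b M K x k ^+ 2 * second_difference a b M K x k ^+ 2.

Lemma dissipationE (R : realType) (a b M : R) (K : nat) (x : 'rV[R]_K.-1) :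
  0 < M -> (0 < K)%N ->
  dissipation a b M x = (\sum_(1 <= k < K.+1) zval a b M K x k ^+ 2 *
    (zval a b M K x k.+1 - 2 * zval a b M K x k + zval a b M K x k.-1) ^+ 2)
    / delta M K ^+ 3.
Proof.
move=> M0 K0; rewrite /dissipation mulr_sumr mulr_suml; apply: eq_bigr => k _.
by rewrite /second_difference; field; rewrite gt_eqF// delta_gt0.
Qed.

Lemma dissipation_ge0 (R : realType) (a b M : R) (K : nat) (x : 'rV[R]_K.-1) :
  0 < M -> (0 < K)%N -> 0 <= dissipation a b M x.
Proof.
move=> M0 K0; rewrite mulr_ge0 ?(ltW (delta_gt0 M0 K0))// sumr_ge0// => k _.
by rewrite mulr_ge0 ?sqr_ge0.
Qed.

(** The evolution equation writes the displacement of the nodes as an increment of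
    z^2 times the second difference; pairing it with the gradient of the entropy and
    summing by parts moves the second difference onto the gradient. *)
Lemma entropy_step_le (R : realType) (a b M tau : R) (K : nat)
    (x y : 'rV[R]_K.-1) :
  0 < M -> 0 < tau -> (0 < K)%N ->
  monotone_vectors a b K x -> monotone_vectors a b K y ->
  discrete_evolution a b M tau K y x ->
  entropy a b M K x + tau * dissipation a b M x <= entropy a b M K y.
Proof.
move=> M0 t0 K0 mx my ev.
have := entropy_diff_le M0 K0 mx my.
suff -> : \sum_(1 <= k < K) (node a b K x k - node a b K y k) *
    (zval a b M K x k.+1 - zval a b M K x k) = - (tau * dissipation a b M x).
  by lra.
set z := zval a b M K x.
pose p k := z k.+1 - z k.
pose G k := tau / delta M K * (z k ^+ 2 * second_difference a b M K x k).
have d0 := delta_gt0 M0 K0.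
transitivity (\sum_(1 <= k < K) p k * (G k.+1 - G k)).
  apply: eq_big_nat => k kK; have := ev k kK; rewrite -/z => e.
  have -> : node a b K x k - node a b K y k = tau *
     ((node a b K x k - node a b K y k) / tau) by field; rewrite gt_eqF.
  by rewrite e /p /G; field; rewrite gt_eqF.
rewrite sum_by_parts//; [|by rewrite /p /z zval_first subrr|];
  last by rewrite /p /z zval_last// subrr.
rewrite /dissipation !mulr_sumr; congr (- _); apply: eq_big_nat => -[//|k] kK.
by rewrite /p /G /second_difference -/z/=; field; rewrite gt_eqF.
Qed.

(** The mean M / (b - a) can be subtracted cell by cell, since all K cells carry the
    same mass. *)
Lemma entropyE (R : realType) (a b M : R) (K : nat) (x : 'rV[R]_K.-1) :
  a < b -> 0 < M -> (0 < K)%N -> monotone_vectors a b K x ->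
  entropy a b M K x =
  delta M K * \sum_(1 <= k < K.+1) ln (zval a b M K x k / (M / (b - a))).
Proof.
move=> ab M0 K0 mx.
rewrite (eq_big_nat _ _ (F2 := fun k => ln (zval a b M K x k) - ln (M / (b - a)))).
  rewrite sumrB sumr_const_nat subn1/= mulrBr -mulr_natr /entropy; congr (_ - _).
  by rewrite -{1}(delta_mul M K0); ring.
move=> k kK; rewrite ln_div// posrE; first exact: zval_gt0.
by rewrite divr_gt0// subr_gt0.
Qed.

Lemma entropy_ge0 (R : realType) (a b M : R) (K : nat) (x : 'rV[R]_K.-1) :
  a < b -> 0 < M -> (0 < K)%N -> monotone_vectors a b K x ->
  0 <= entropy a b M K x.
Proof.
move=> ab M0 K0 mx; rewrite entropyE//.
have L0 : 0 < b - a by rewrite subr_gt0.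
set u := M / (b - a); have u0 : 0 < u by rewrite divr_gt0.
have d0 := delta_gt0 M0 K0.
rewrite [leLHS](_ : 0 = \sum_(1 <= k < K.+1)
    (delta M K - u * (node a b K x k - node a b K x k.-1))); last first.
  rewrite sumrB -[X in _ - X]mulr_sumr sum_gap// sumr_const_nat subn1/= -mulr_natr delta_mul//.
  by rewrite /u divfK ?gt_eqF// subrr.
rewrite mulr_sumr; apply: ler_sum_nat => k kK.
have zk := zval_gt0 M0 K0 mx kK.
rewrite -(zval_gap M mx kK).
set g := node a b K x k - _; have g0 : 0 < g by exact: gap_gt0.
have : ln (1 + (u / zval a b M K x k - 1)) <= u / zval a b M K x k - 1.
  by rewrite le_ln1Dx//; have := divr_gt0 u0 zk; lra.
rewrite (_ : 1 + _ = (zval a b M K x k / u)^-1); last first.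
  by field; rewrite !gt_eqF.
have zu : 0 < zval a b M K x k / u by rewrite divr_gt0.
rewrite lnV ?posrE// => h.
rewrite [leLHS](_ : _ = zval a b M K x k * g * (1 - u / zval a b M K x k)).
  rewrite (ler_pM2l (mulr_gt0 zk g0)).
  by lra.
by field; rewrite gt_eqF.
Qed.

Lemma entropy_le_dissipation (R : realType) (a b M : R) (K : nat)
    (x : 'rV[R]_K.-1) :
  a < b -> 0 < M -> (0 < K)%N -> monotone_vectors a b K x ->
  entropy a b M K x <= 4 * (b - a) ^+ 4 * dissipation a b M x.
Proof.
move=> ab M0 K0 mx; rewrite entropyE// dissipationE//.
have := @relative_entropy_le R (delta M K) (b - a) _ K
  (fun k => node a b K x k - node a b K x k.-1) (zval a b M K x) K0
  (delta_gt0 M0 K0) (fun k => zval_gt0 M0 K0 mx) (fun k => @zval_gap _ a b M K x k mx)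
  (zval_first _ _ _ _) (zval_last _ _ _ _ K0) (esym (sum_gap _ _ _ K0)) erefl.
by rewrite delta_mul.
Qed.

(** The implicit step contracts by a rational factor, so an exponential rate that is
    uniform in the step needs the upper bound T for tau. *)
Lemma inv_1D_le_expR (R : realType) (r tau T : R) :
  0 < r -> 0 < tau -> tau <= T -> (1 + tau / r)^-1 <= expR (- (tau / (r + T))).
Proof.
move=> r0 t0 tT.
apply: le_trans (expR_ge1Dx _).
have rt : 0 < r + tau by rewrite addr_gt0.
rewrite (_ : (1 + tau / r)^-1 = 1 - tau / (r + tau)); last first.
  by field; rewrite !gt_eqF// mulr1 addrC.
by rewrite lerD2l lerN2 ler_pM2l// lef_pV2 ?posrE ?lerD2l//; lra.
Qed.

Lemma entropy_decay_step (R : realType) (a b M tau T : R) (K : nat)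
    (x y : 'rV[R]_K.-1) :
  a < b -> 0 < M -> 0 < tau -> tau <= T -> (0 < K)%N ->
  monotone_vectors a b K x -> monotone_vectors a b K y ->
  discrete_evolution a b M tau K y x ->
  entropy a b M K x <=
  entropy a b M K y * expR (- (tau / (4 * (b - a) ^+ 4 + T))).
Proof.
move=> ab M0 t0 tT K0 mx my ev.
have c0 : 0 < 4 * (b - a) ^+ 4 by rewrite mulr_gt0// exprn_gt0// subr_gt0.
have Hx := entropy_ge0 ab M0 K0 mx; have Hy := entropy_ge0 ab M0 K0 my.
have step := entropy_step_le M0 t0 K0 mx my ev.
have fi := entropy_le_dissipation ab M0 K0 mx.
set c := 4 * _ in c0 fi *.
apply: (@le_trans _ _ (entropy a b M K y * (1 + tau / c)^-1)); last first.
  by rewrite ler_wpM2l// inv_1D_le_expR.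
have tc : 0 < tau / c by rewrite divr_gt0.
rewrite ler_pdivlMr; last by lra.
apply: le_trans step; rewrite mulrDr mulr1 lerD2l mulrCA ler_pM2l//.
by rewrite ler_pdivrMr// mulrC.
Qed.

(** * The Euler--Lagrange equation *)

Lemma is_derive_sqr (R : realType) (f : R -> R) (t df : R) :
  is_derive t 1 f df -> is_derive t 1 (fun s => f s ^+ 2) (2 * f t * df).
Proof.
move=> fd; apply: (is_derive_eq (is_deriveM fd fd)).
by rewrite /GRing.scale/=; ring.
Qed.

Lemma is_derive_mull (R : realType) (c : R) (f : R -> R) (t df : R) :
  is_derive t 1 f df -> is_derive t 1 (fun s => c * f s) (c * df).
Proof. by move=> fd; exact: is_deriveZ. Qed.

Lemma is_derive_add (R : realType) (f g : R -> R) (t df dg : R) :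
  is_derive t 1 f df -> is_derive t 1 g dg ->
  is_derive t 1 (fun s => f s + g s) (df + dg).
Proof. by move=> fd gd; exact: is_deriveD. Qed.

Lemma is_derive_affine (R : realType) (u c t : R) :
  is_derive t 1 (fun s => u + c * s) c.
Proof.
apply: (is_derive_eq (is_derive_add (is_derive_cst u t 1)
  (is_derive_mull c (is_derive_id t 1)))).
by rewrite add0r mulr1.
Qed.

Lemma is_derive_sum_nat (R : realType) (m n : nat) (f : nat -> R -> R) (t : R)
    (df : nat -> R) :
  (forall k, is_derive t 1 (f k) (df k)) ->
  is_derive t 1 (fun s => \sum_(m <= k < n) f k s) (\sum_(m <= k < n) df k).
Proof.
move=> fd; elim: n => [|n IH].
  rewrite (_ : (fun s => _) = cst 0); first by rewrite big_geq//; exact: is_derive_cst.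
  by apply/funext => s; rewrite big_geq.
have [mn|nm] := leqP m n.
  rewrite big_nat_recr//=.
  rewrite (_ : (fun s => _) = (fun s => \sum_(m <= k < n) f k s) + f n).
    exact: is_deriveD.
  by apply/funext => s; rewrite big_nat_recr.
rewrite (_ : (fun s => _) = cst 0); first by rewrite big_geq//; exact: is_derive_cst.
by apply/funext => s; rewrite big_geq.
Qed.

Lemma node_shift (R : realType) (a b t : R) (K : nat) (x : 'rV[R]_K.-1)
    (i : 'I_K.-1) (k : nat) :
  node a b K (x + t *: delta_mx ord0 i) k =
  node a b K x k + t * (k == i.+1)%:R.
Proof.
case: k => [|k] /=; first by rewrite mulr0 addr0.
case: insubP => [j _ jk|kK].
  by rewrite !mxE eqxx/= -jk eqSS.
by rewrite eqSS (_ : (k == i) = false) ?mulr0 ?addr0//; have := ltn_ord i; lia.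
Qed.

(** Only the two cells adjacent to the moved node change their lengths. *)
Lemma monotone_shift (R : realType) (a b : R) (K : nat) (x : 'rV[R]_K.-1)
    (i : 'I_K.-1) :
  monotone_vectors a b K x ->
  exists2 e : R, 0 < e & forall t, t \in `]- e, e[%R ->
    monotone_vectors a b K (x + t *: delta_mx ord0 i).
Proof.
move=> mx; have iK := ltn_ord i.
pose e := Num.min (node a b K x i.+1 - node a b K x i)
                  (node a b K x i.+2 - node a b K x i.+1).
have e0 : 0 < e by rewrite lt_min !subr_gt0 !mx//; lia.
exists e => // t; rewrite in_itv/= => /andP[].
rewrite ltrNl !lt_min => /andP[t1 t2] /andP[t3 t4] k kK.
rewrite !node_shift eqSS; have mk := mx k kK.
have [->|ki] := eqVneq k i.+1.
  by rewrite (_ : (i.+1 == i) = false) ?mulr0 ?mulr1 ?addr0; [lra | lia].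
have [->|ki'] := eqVneq k i; last by rewrite !mulr0 !addr0.
by rewrite mulr0 mulr1 addr0; lra.
Qed.

(** The index j removes the convention for the two ghost cells: those move with the
    boundary cell that they copy. *)
Lemma is_derive_zval (R : realType) (a b M t : R) (K : nat) (x : 'rV[R]_K.-1)
    (i : 'I_K.-1) (k : nat) (y := x + t *: delta_mx ord0 i)
    (j := minn (maxn k 1) K) :
  0 < M -> monotone_vectors a b K y ->
  is_derive t 1 (fun s => zval a b M K (x + s *: delta_mx ord0 i) k)
    (- (zval a b M K y k ^+ 2 / delta M K *
        ((j == i.+1)%:R - (j.-1 == i.+1)%:R))).
Proof.
move=> M0 my; have iK := ltn_ord i.
have K0 : (0 < K)%N by lia.
have d0 := delta_gt0 M0 K0.
set c : R := _ - _.
have gE s : node a b K (x + s *: delta_mx ord0 i) j -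
    node a b K (x + s *: delta_mx ord0 i) j.-1 =
    node a b K x j - node a b K x j.-1 + s * c.
  by rewrite !node_shift /c; ring.
have g0 : 0 < node a b K y j - node a b K y j.-1 by apply: gap_gt0 => //; lia.
rewrite (_ : (fun s => _) = (fun s => delta M K *
  (node a b K x j - node a b K x j.-1 + c * s)^-1)); last first.
  by apply/funext => s; rewrite /zval -/j gE [c * s]mulrC.
move: g0; rewrite gE [t * c]mulrC => g0.
apply: is_derive_eq.
  apply: is_derive_mull.
  by apply: is_deriveV (is_derive_affine _ c t); rewrite gt_eqF.
rewrite /zval -/j gE [t * c]mulrC /GRing.scale/=.
by field; rewrite !gt_eqF.
Qed.

Lemma is_derive_step_functional (R : realType) (a b M tau t : R) (K : nat)
    (y x : 'rV[R]_K.-1) (i : 'I_K.-1) (w := x + t *: delta_mx ord0 i) :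
  0 < M -> 0 < tau -> monotone_vectors a b K w ->
  is_derive t 1
    (fun s => step_functional a b M tau K y (x + s *: delta_mx ord0 i))
    (delta M K / tau * (node a b K w i.+1 - node a b K y i.+1)
     - (zval a b M K w i.+2 ^+ 2 * second_difference a b M K w i.+2
        - zval a b M K w i.+1 ^+ 2 * second_difference a b M K w i.+1)).
Proof.
move=> M0 t0 mw; have iK := ltn_ord i.
have K0 : (0 < K)%N by lia.
have d0 := delta_gt0 M0 K0.
set z := zval a b M K w.
pose c k : R := let j := minn (maxn k 1) K in (j == i.+1)%:R - (j.-1 == i.+1)%:R.
pose dz k := - (z k ^+ 2 / delta M K * c k).
have dzP k : is_derive t 1 (fun s => zval a b M K (x + s *: delta_mx ord0 i) k) (dz k).
  exact: is_derive_zval.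
have distP k : is_derive t 1
    (fun s => (node a b K (x + s *: delta_mx ord0 i) k - node a b K y k) ^+ 2)
    (2 * (node a b K w k - node a b K y k) * (k == i.+1)%:R).
  apply: is_derive_sqr.
  rewrite (_ : (fun s => _) = (fun s => (node a b K x k - node a b K y k)
     + (k == i.+1)%:R * s)); first exact: is_derive_affine.
  by apply/funext => s; rewrite node_shift; ring.
have slopeP k : is_derive t 1
    (fun s => ((zval a b M K (x + s *: delta_mx ord0 i) k.+1
       - zval a b M K (x + s *: delta_mx ord0 i) k) / delta M K) ^+ 2)
    (2 * ((z k.+1 - z k) / delta M K) * ((delta M K)^-1 * (dz k.+1 - dz k))).
  apply: is_derive_sqr.
  rewrite (_ : (fun s => _) = (fun s => (delta M K)^-1 *
     (zval a b M K (x + s *: delta_mx ord0 i) k.+1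
      - zval a b M K (x + s *: delta_mx ord0 i) k))).
    by apply: is_derive_mull; exact: (is_deriveB (dzP k.+1) (dzP k)).
  by apply/funext => s; rewrite mulrC.
apply: (is_derive_eq (is_derive_add
  (is_derive_mull _ (is_derive_sum_nat 1 K distP))
  (is_derive_mull _ (is_derive_sum_nat 1 K slopeP)))).
congr (_ + _).
  have ik : (1 <= i.+1 < K)%N by lia.
  rewrite (bigD1_seq i.+1) ?mem_index_iota ?iota_uniq//= eqxx.
  rewrite mulr1 big1 => [|k /negPf ->]; last by rewrite mulr0.
  by field; rewrite gt_eqF.
(* Summation by parts moves the difference from dz onto the slopes p; then only the two
   cells next to the moved node contribute. *)
pose p k := z k.+1 - z k.
transitivity ((delta M K)^-1 * \sum_(1 <= k < K) p k * (dz k.+1 - dz k)).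
  by rewrite !mulr_sumr; apply: eq_bigr => k _; rewrite -/z /p; field; rewrite gt_eqF.
rewrite sum_by_parts//; [|by rewrite /p /z zval_first subrr|];
  last by rewrite /p /z zval_last// subrr.
pose G k := z k ^+ 2 * second_difference a b M K w k.
transitivity (\sum_(1 <= k < K.+1) G k * ((k == i.+1)%:R - (k == i.+2)%:R)).
  rewrite mulrN mulr_sumr -sumrN; apply: eq_big_nat => -[//|k] kK.
  rewrite /p /dz /c /G /second_difference -/z/=.
  rewrite (_ : minn _ _ = k.+1)/= ?eqSS; last by lia.
  by field; rewrite gt_eqF.
under eq_bigr do rewrite mulrBr.
have pick j : (1 <= j <= K)%N -> \sum_(1 <= k < K.+1) G k * (k == j)%:R = G j.
  move=> jK; rewrite (bigD1_seq j) ?mem_index_iota ?iota_uniq//= eqxx mulr1.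
  by rewrite big1 ?addr0// => k /negPf ->; rewrite mulr0.
by rewrite sumrB !pick /G; [ring | lia | lia].
Qed.

Lemma minimizer_evolution (R : realType) (a b M tau : R) (K : nat)
    (y x : 'rV[R]_K.-1) :
  0 < M -> 0 < tau ->
  global_minimizer (monotone_vectors a b K) (step_functional a b M tau K y) x ->
  discrete_evolution a b M tau K y x.
Proof.
move=> M0 t0 [mx xmin] k kK.
have K0 : (0 < K)%N by lia.
have d0 := delta_gt0 M0 K0.
have ik : (k.-1 < K.-1)%N by lia.
pose i := Ordinal ik.
have ki : k = i.+1 by rewrite /=; lia.
have [e e0 me] := monotone_shift i mx.
pose f s := step_functional a b M tau K y (x + s *: delta_mx ord0 i).
have x0 : x + 0 *: delta_mx ord0 i = x by rewrite scale0r addr0.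
have : is_derive (0 : R) (1 : R) f 0.
  apply: (@derive1_at_min _ f (- e) e).
  - by rewrite ge0_cp// ltW.
  - by move=> t te; have [] := is_derive_step_functional y M0 t0 (me t te).
  - by rewrite in_itv/= oppr_lt0 e0.
  - by move=> t te; rewrite /f x0; apply: xmin; exact: me.
have mx0 : monotone_vectors a b K (x + 0 *: delta_mx ord0 i) by rewrite x0.
have := is_derive_step_functional y M0 t0 mx0.
rewrite -/f x0 => -[_ df] -[_]; rewrite df -ki => /eqP; rewrite subr_eq0 => /eqP <-.
by field; rewrite !gt_eqF.
Qed.

(** * Existence of minimizers *)

Lemma fisher_ge0 (R : realType) (a b M : R) (K : nat) (x : 'rV[R]_K.-1) :
  0 < M -> (0 < K)%N -> 0 <= fisher a b M K x.
Proof.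
move=> M0 K0; apply: mulr_ge0; first by rewrite divr_ge0// ltW// delta_gt0.
by apply: sumr_ge0 => k _; exact: sqr_ge0.
Qed.

Lemma fisher_le_step_functional (R : realType) (a b M tau : R) (K : nat)
    (y x : 'rV[R]_K.-1) :
  0 < M -> 0 < tau -> (0 < K)%N ->
  fisher a b M K x <= step_functional a b M tau K y x.
Proof.
move=> M0 t0 K0; rewrite /step_functional lerDr; apply: mulr_ge0.
  by rewrite divr_ge0 ?(ltW (delta_gt0 M0 K0))// mulr_ge0// ltW.
by apply: sumr_ge0 => k _; exact: sqr_ge0.
Qed.

Lemma step_functional_self (R : realType) (a b M tau : R) (K : nat)
    (y : 'rV[R]_K.-1) :
  step_functional a b M tau K y y = fisher a b M K y.
Proof.
rewrite /step_functional big1 ?mulr0 ?add0r// => k _.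
by rewrite subrr expr0n.
Qed.

(** The values of z cannot all exceed the mean density, and the total variation of z is
    controlled by the Fisher information through t <= t^2 + 1. *)
Lemma zval_le (R : realType) (a b M : R) (K : nat) (x : 'rV[R]_K.-1) (k : nat) :
  a < b -> 0 < M -> (0 < K)%N -> monotone_vectors a b K x -> (1 <= k <= K)%N ->
  zval a b M K x k <=
  M / (b - a) + 2 * delta M K * fisher a b M K x + K%:R.
Proof.
move=> ab M0 K0 mx kK.
have L0 : 0 < b - a by rewrite subr_gt0.
have d0 := delta_gt0 M0 K0.
set u := M / (b - a); have u0 : 0 < u by rewrite divr_gt0.
pose g j := node a b K x j - node a b K x j.-1.
have [j jK zj] : exists2 j, (1 <= j <= K)%N & 0 <= u * g j - delta M K.
  apply: exists_ge0_of_sum0 => //.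
  rewrite sumrB -[X in X - _]mulr_sumr sum_gap// sumr_const_nat subn1/=.
  by rewrite -mulr_natr delta_mul// /u divfK ?subrr// gt_eqF.
have {}zj : zval a b M K x j <= u.
  by rewrite zvalE// ler_pdivrMr ?gap_gt0// -subr_ge0.
have := ler_dist_sum (zval a b M K x) kK jK.
suff : \sum_(1 <= i < K) `|zval a b M K x i.+1 - zval a b M K x i| <=
    2 * delta M K * fisher a b M K x + K%:R.
  by have := ler_norm (zval a b M K x k - zval a b M K x j); lra.
have -> : 2 * delta M K * fisher a b M K x =
    \sum_(1 <= i < K) (zval a b M K x i.+1 - zval a b M K x i) ^+ 2.
  rewrite /fisher !mulr_sumr; apply: eq_bigr => i _.
  by field; rewrite gt_eqF.
apply: (@le_trans _ _ (\sum_(1 <= i < K)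
   ((zval a b M K x i.+1 - zval a b M K x i) ^+ 2 + 1))).
  apply: ler_sum => i _; set d := _ - _.
  by have := real_normK (num_real d); have := sqr_ge0 (`|d| - 1); nra.
by rewrite big_split/= lerD2l sumr_const_nat ler_nat leq_subr.
Qed.

Lemma node_mem_segment (R : realType) (a b : R) (K : nat) (x : 'rV[R]_K.-1)
    (k : nat) :
  (0 < K)%N -> monotone_vectors a b K x -> a <= node a b K x k <= b.
Proof.
move=> K0 mx.
have step j : node a b K x j <= node a b K x j.+1.
  have [jK|Kj] := ltnP j K; first by rewrite ltW// mx.
  by rewrite !node_ge_last//; lia.
apply/andP; split.
  by elim: k => // k IH; apply: le_trans IH (step k).
have up m : node a b K x k <= node a b K x (m + k).
  by elim: m => // m IH; apply: le_trans IH (step _).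
by apply: le_trans (up K) _; rewrite node_ge_last// leq_addr.
Qed.

Lemma node_continuous (R : realType) (a b : R) (K : nat) (k : nat) :
  continuous (fun x : 'rV[R]_K.-1 => node a b K x k).
Proof.
case: k => [|k] /=.
  exact: cst_continuous.
by case: insubP => [i _ _|_]; [exact: coord_continuous | exact: cst_continuous].
Qed.

Lemma gap_continuous (R : realType) (a b : R) (K : nat) (k j : nat) :
  continuous (fun x : 'rV[R]_K.-1 => node a b K x k - node a b K x j).
Proof.
by move=> x; apply: (@continuousB _ _ 'rV[R]_K.-1); exact: node_continuous.
Qed.

Lemma zval_continuous (R : realType) (a b M : R) (K : nat) (x : 'rV[R]_K.-1)
    (k : nat) : (0 < K)%N -> monotone_vectors a b K x ->
  {for x, continuous (fun v => zval a b M K v k)}.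
Proof.
move=> K0 mx.
apply: (@continuousM _ 'rV[R]_K.-1 (cst (delta M K))); first exact: cst_continuous.
apply: (@continuousV _ 'rV[R]_K.-1); last exact: gap_continuous.
by rewrite gt_eqF// gap_gt0//; lia.
Qed.

Lemma continuous_sum_sqr (R : realType) (T : topologicalType) (c : R)
    (m n : nat) (f : nat -> T -> R) (x : T) :
  (forall k, {for x, continuous (f k)}) ->
  {for x, continuous (fun v => c * \sum_(m <= k < n) f k v ^+ 2)}.
Proof.
move=> cf; apply: (@continuousM _ T (cst c)); first exact: cst_continuous.
apply: cvg_big => [|k _]; first exact: add_continuous.
exact: (@continuousM _ T (f k) (f k)).
Qed.

Lemma step_functional_continuous (R : realType) (a b M tau : R) (K : nat)
    (y x : 'rV[R]_K.-1) : (0 < K)%N -> monotone_vectors a b K x ->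
  {for x, continuous (step_functional a b M tau K y)}.
Proof.
move=> K0 mx; apply: (@continuousD _ _ 'rV[R]_K.-1);
  apply: (@continuous_sum_sqr _ 'rV[R]_K.-1) => k.
  apply: (@continuousB _ _ 'rV[R]_K.-1); first exact: node_continuous.
  exact: cst_continuous.
apply: (@continuousM _ 'rV[R]_K.-1); last exact: cst_continuous.
by apply: (@continuousB _ _ 'rV[R]_K.-1); exact: zval_continuous.
Qed.

Definition separated_vectors (R : realType) (a b c : R) (K : nat) :
    set 'rV[R]_K.-1 :=
  [set x | forall k, (k < K)%N -> c <= node a b K x k.+1 - node a b K x k].

Lemma separated_monotone (R : realType) (a b c : R) (K : nat) :
  0 < c -> separated_vectors a b c (K := K) `<=` monotone_vectors a b K.
Proof.
by move=> c0 x sx k kK; rewrite -subr_gt0; apply: lt_le_trans c0 (sx k kK).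
Qed.

Lemma separated_compact (R : realType) (a b c : R) (K : nat) :
  (0 < K)%N -> 0 < c -> compact (separated_vectors a b c (K := K)).
Proof.
move=> K0 c0.
apply: (@subclosed_compact _ _
  [set v : 'rV[R]_K.-1 | forall i, `[a, b]%classic (v ord0 i)]).
- rewrite (_ : separated_vectors a b c (K := K) =
    \bigcap_(k in [set k | (k < K)%N])
      ((fun x : 'rV[R]_K.-1 => node a b K x k.+1 - node a b K x k)
         @^-1` [set t | c <= t])); last by apply/seteqP; split.
  apply: closed_bigI => k _; apply: preimage_closed; last exact: closed_ge.
  by move=> x _; exact: gap_continuous.
- by apply: (@rV_compact _ _ (fun=> `[a, b]%classic)) => i; exact: segment_compact.
- move=> x /(separated_monotone c0) mx i /=.
  have := node_mem_segment i.+1 K0 mx.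
  by rewrite in_itv/= valK.
Qed.

(** A competitor that does at least as well as y itself has Fisher information at most
    that of y, so its z values are at most Z and its gaps are at least c.  It is therefore
    enough to minimize over the compact set of c-separated vectors. *)
Lemma exists_minimizer (R : realType) (a b M tau : R) (K : nat)
    (y : 'rV[R]_K.-1) :
  a < b -> 0 < M -> 0 < tau -> (0 < K)%N -> monotone_vectors a b K y ->
  exists x, global_minimizer (monotone_vectors a b K)
              (step_functional a b M tau K y) x.
Proof.
move=> ab M0 t0 K0 my.
have d0 := delta_gt0 M0 K0.
pose Z := M / (b - a) + 2 * delta M K * fisher a b M K y + K%:R.
have Z0 : 0 < Z.
  rewrite /Z addr_gt0 ?ltr0n// ltr_wpDr ?divr_gt0 ?subr_gt0//.
  by rewrite mulr_ge0 ?fisher_ge0// mulr_ge0// ltW.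
pose c := delta M K / Z; have c0 : 0 < c by rewrite divr_gt0.
have low w : monotone_vectors a b K w ->
    fisher a b M K w <= fisher a b M K y -> separated_vectors a b c w.
  move=> mw Fw k kK.
  have kK' : (1 <= k.+1 <= K)%N by lia.
  have g0 := gap_gt0 mw kK'; rewrite /= in g0.
  have := zval_le ab M0 K0 mw kK'; rewrite zvalE//= ler_pdivrMr// => zle.
  rewrite /c ler_pdivrMr// mulrC; apply: (le_trans zle).
  by rewrite ler_pM2r// /Z lerD2r lerD2l ler_pM2l// mulr_gt0.
have sy : separated_vectors a b c y by exact: low.
have [|x] := @EVT_min_rV R K.-1 (step_functional a b M tau K y)
  (separated_vectors a b c (K := K)) (ex_intro _ y sy) (separated_compact K0 c0).
  apply: continuous_in_subspaceT => x; rewrite inE => /(separated_monotone c0) mx.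
  exact: step_functional_continuous.
rewrite inE => sx xmin; exists x; split; first exact: (separated_monotone c0).
move=> w mw; have [Jw|Jw] := leP (step_functional a b M tau K y w) (fisher a b M K y).
  apply: xmin; rewrite inE; apply: low => //.
  exact: le_trans (fisher_le_step_functional a b y w M0 t0 K0) Jw.
apply: le_trans (ltW Jw); rewrite -(step_functional_self a b M tau y).
by apply: xmin; rewrite inE.
Qed.

(** * Positivity and mass of the density *)

(** For k = 0 and for k > K both nodes coincide and the quotient is zero. *)
Lemma cell_weight_ge0 (R : realType) (a b M : R) (K : nat) (x : 'rV[R]_K.-1)
    (k : nat) :
  0 < M -> (0 < K)%N -> monotone_vectors a b K x ->
  0 <= delta M K / (node a b K x k - node a b K x k.-1).
Proof.
move=> M0 K0 mx; have d0 := delta_gt0 M0 K0.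
have [kK|] := boolP (1 <= k <= K)%N; first by rewrite divr_ge0 ?ltW ?gap_gt0.
case: k => [|k] kK; first by rewrite subrr invr0 mulr0.
by rewrite !node_ge_last ?subrr ?invr0 ?mulr0//=; lia.
Qed.

Lemma cell_cover (R : realType) (a b : R) (K : nat) (x : 'rV[R]_K.-1) (t : R) :
  (0 < K)%N -> a <= t <= b -> exists2 k, (1 <= k <= K)%N & cell a b K x k t.
Proof.
move=> K0 /andP[a_t tb].
suff H n : t <= node a b K x n.+1 ->
    exists2 k, (1 <= k <= n.+1)%N & cell a b K x k t.
  by have := H K.-1; rewrite prednK// node_last//; exact.
elim: n => [|n IH] tn; first by exists 1%N => //; rewrite /cell/= in_itv/= a_t.
have [tn1|nt1] := leP t (node a b K x n.+1).
  by have [k kn ck] := IH tn1; exists k => //; lia.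
by exists n.+2; [lia | rewrite /cell/= in_itv/= nt1].
Qed.

Lemma density_gt0 (R : realType) (a b M : R) (K : nat) (x : 'rV[R]_K.-1)
    (t : R) :
  0 < M -> (0 < K)%N -> monotone_vectors a b K x -> a <= t <= b ->
  0 < density a b M K x t.
Proof.
move=> M0 K0 mx tab; have [k kK ck] := cell_cover x K0 tab.
rewrite /density (bigD1_seq k) ?mem_index_iota ?iota_uniq//= ltr_wpDr//.
  apply: sumr_ge0 => j _; apply: mulr_ge0; first exact: cell_weight_ge0.
  by rewrite indicE ler0n.
rewrite indicE mem_set// mulr1 divr_gt0 ?delta_gt0 ?gap_gt0//.
Qed.

Lemma measurable_cell (R : realType) (a b : R) (K : nat) (x : 'rV[R]_K.-1)
    (k : nat) : measurable (cell a b K x k : set R).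
Proof. by rewrite /cell; case: ifP => _; exact: measurable_itv. Qed.

Lemma lebesgue_measure_cell (R : realType) (a b : R) (K : nat)
    (x : 'rV[R]_K.-1) (k : nat) :
  monotone_vectors a b K x -> (1 <= k <= K)%N ->
  lebesgue_measure (cell a b K x k) =
  (node a b K x k - node a b K x k.-1)%:E.
Proof.
move=> mx kK; have := gap_gt0 mx kK; rewrite subr_gt0 => g.
rewrite /cell; case: ifP => [/eqP k1|_].
  by rewrite k1 lebesgue_measure_itv/= lte_fin; rewrite k1/= in g; rewrite g.
by rewrite lebesgue_measure_itv/= lte_fin g.
Qed.

Lemma integral_density (R : realType) (a b M : R) (K : nat)
    (x : 'rV[R]_K.-1) :
  0 < M -> (0 < K)%N -> monotone_vectors a b K x ->
  (\int[lebesgue_measure]_(t in `[a, b]) (density a b M K x t)%:E)%E = M%:E.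
Proof.
move=> M0 K0 mx.
pose c k := delta M K / (node a b K x k - node a b K x k.-1).
have c0 k : 0 <= c k by exact: cell_weight_ge0.
transitivity (\int[lebesgue_measure]_(t in `[a, b])
   \sum_(1 <= k < K.+1) ((c k)%:E * (\1_(cell a b K x k) t)%:E))%E.
  by apply: eq_integral => t _; rewrite -sumEFin.
rewrite ge0_integral_sum//=; last 2 first.
  move=> k; apply: measurable_funeM; apply/measurable_realfun.measurable_EFinP.
  by apply: measurable_realfun.measurable_indic; exact: measurable_cell.
  by move=> k t _; rewrite mule_ge0// lee_fin// indicE ler0n.
transitivity (\sum_(1 <= k < K.+1) (delta M K)%:E)%E.
  apply: eq_big_nat => k kK.
  rewrite ge0_integralZl_EFin//=; last first.
    apply/measurable_realfun.measurable_EFinP.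
    by apply: measurable_realfun.measurable_indic; exact: measurable_cell.
  rewrite integral_indic//=; last exact: measurable_cell.
  rewrite setIidl; last first.
    have /andP[ha _] := node_mem_segment k.-1 K0 mx.
    have /andP[_ hb] := node_mem_segment k K0 mx.
    move=> t; rewrite /cell; case: ifP => [/eqP k1|_]/=; rewrite !in_itv/=.
      by move=> /andP[at_ tk]; rewrite at_ (le_trans tk)//; rewrite k1 in hb.
    by move=> /andP[/ltW kt tk]; rewrite (le_trans ha)// (le_trans tk).
  rewrite lebesgue_measure_cell// -EFinM /c divfK// gt_eqF// gap_gt0//.
by rewrite sumEFin sumr_const_nat subn1/= -mulr_natr delta_mul.
Qed.

(** * The scheme *)

Lemma exists_minimizing_scheme (R : realType) (a b M tau : R) (K : nat)
    (x0 : 'rV[R]_K.-1) :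
  a < b -> 0 < M -> 0 < tau -> (0 < K)%N -> monotone_vectors a b K x0 ->
  exists x, minimizing_scheme a b M tau K x0 x.
Proof.
move=> ab M0 t0 K0 m0.
pose next y := xget x0 (global_minimizer (monotone_vectors a b K)
                          (step_functional a b M tau K y)).
pose x n := iter n next x0.
have nextP y : monotone_vectors a b K y ->
    global_minimizer (monotone_vectors a b K) (step_functional a b M tau K y)
      (next y).
  move=> my; have [w wmin] := exists_minimizer ab M0 t0 K0 my.
  exact: (xgetPex x0 (ex_intro _ w wmin)).
have mx n : monotone_vectors a b K (x n).
  by elim: n => // n IH; have [] := nextP _ IH.
by exists x; split => // n; exact: nextP.
Qed.

Theorem theorem1 (R : realType) :
  exists r : R -> R -> R,
    (forall L T : R, 0 < L -> 0 < T -> 0 < r L T) /\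
    forall (a b M tau : R) (K : nat) (x0 : 'rV[R]_K.-1),
      a < b -> 0 < M -> 0 < tau -> (0 < K)%N ->
      monotone_vectors a b K x0 ->
      (exists x : nat -> 'rV[R]_K.-1, minimizing_scheme a b M tau K x0 x) /\
      forall x : nat -> 'rV[R]_K.-1, minimizing_scheme a b M tau K x0 x ->
        (forall n, monotone_vectors a b K (x n)) /\
        (forall n, discrete_evolution a b M tau K (x n) (x n.+1)) /\
        (forall n t, a <= t <= b -> 0 < density a b M K (x n) t) /\
        (forall n, (\int[lebesgue_measure]_(t in `[a, b])
                      (density a b M K (x n) t)%:E)%E = M%:E) /\
        (forall n, entropy a b M K (x n.+1) <= entropy a b M K (x n)) /\
        (forall n, fisher a b M K (x n.+1) <= fisher a b M K (x n)) /\
        (forall (T : R) n, tau <= T ->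
           entropy a b M K (x n) <=
           entropy a b M K x0 * expR (- (r (b - a) T * n%:R * tau))).
Proof.
exists (fun L T => (4 * L ^+ 4 + T)^-1); split.
  by move=> L T L0 T0; rewrite invr_gt0 addr_gt0// mulr_gt0// exprn_gt0.
move=> a b M tau K x0 ab M0 t0 K0 m0; split.
  exact: exists_minimizing_scheme.
move=> x [x0E xmin].
have mx n : monotone_vectors a b K (x n).
  by case: n => [|n]; [rewrite x0E | have [] := xmin n].
have ev n : discrete_evolution a b M tau K (x n) (x n.+1).
  exact: minimizer_evolution.
split=> //; split=> //; split; first by move=> n t; exact: density_gt0.
split; first by move=> n; exact: integral_density.
split.
  move=> n; apply: le_trans (entropy_step_le M0 t0 K0 (mx n.+1) (mx n) (ev n)).
  by rewrite lerDl mulr_ge0 ?dissipation_ge0// ltW.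
split.
  move=> n; rewrite -[leRHS](step_functional_self a b M tau).
  apply: le_trans (fisher_le_step_functional a b (x n) _ M0 t0 K0) _.
  by have [_] := xmin n; apply.
move=> T n tT; elim: n => [|n IH].
  by rewrite mulr0 mul0r oppr0 expR0 mulr1 x0E.
apply: (le_trans (entropy_decay_step ab M0 t0 tT K0 (mx n.+1) (mx n) (ev n))).
set r := (4 * (b - a) ^+ 4 + T)^-1.
have -> : - (r * n.+1%:R * tau) = - (r * n%:R * tau) + - (tau * r).
  by rewrite -natr1; ring.
by rewrite expRD mulrA ler_wpM2r// expR_ge0.
Qed.
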